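(* Let $\mathcal L$ be an MV-algebra, let $F\subseteq\mathcal L$ be a prime filter, let $\eta\colon\mathcal L\to\mathcal L/\mathcal K(F)$ be the canonical epimorphism, and let $a,b\in\mathcal L$ with $a,b\notin F$. Then: (i) if $a\le b$ and $F_a=F_b$, then $\eta(a)=\eta(b)$; (ii) if $F_a=F_b$, then $\eta(a)=\eta(b)$; (iii) if $F_a\subseteq F_b$, then $\eta(a)\ge\eta(b)$.
   Context: $\mathcal L$ is an MV-algebra with operations $\oplus,\neg,0,1$; $x\otimes y=\neg(\neg x\oplus\neg y)$, $x\to y=\neg x\oplus y$; the order is $x\le y$ iff $x\to y=1$, with lattice operations $\wedge,\vee$. An order filter is a nonempty upward-closed subset. An implication filter is an order filter closed under $\otimes$. A prime filter is a proper order filter $F$ closed under $\wedge$ such that $x\vee y\in F$ implies $x\in F$ or $y\in F$. The subordinate of $F$ at $a$ is $F_a=\{z\in\mathcal L\mid z\to a\notin F\}$. The kernel is $\mathcal K(F)=\{z\in\mathcal L \mid \text{for all } c\notin F,\ z\to c\notin F\}$, which is an implication filter. For an implication filter $Q$, $\mathcal L/Q$ is the quotient MV-algebra by the congruence $x\sim y$ iff $x\to y\in Q$ and $y\to x\in Q$. *)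

(* Defs.v *)
From HB Require Import structures.
From mathcomp Require Import all_boot all_order.
From mathcomp Require Import boolp classical_sets.

Set Implicit Arguments.
Unset Strict Implicit.
Unset Printing Implicit Defensive.

Import Order.TTheory.

Local Open Scope quotient_scope.
Local Open Scope classical_set_scope.
Local Open Scope order_scope.

Declare Scope mv_scope.
Delimit Scope mv_scope with MV.

Reserved Notation "x ⊕ y" (at level 50, left associativity).
Reserved Notation "x ⊗ y" (at level 45, left associativity).
Reserved Notation "x ⇒ y" (at level 55, right associativity).
Reserved Notation "¬ x" (at level 35, right associativity).

(* The order, hence the lattice operations `&` and `|`, are determined by    *)
(* oplus and neg through mv_leE; the factory isMVAlgebra below builds the    *)
(* whole structure from the equational axioms alone.                         *)
HB.mixin Record Lattice_isMVAlgebra (d : Order.disp_t) T of Order.Lattice d T := {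
  oplus : T -> T -> T;
  neg : T -> T;
  mv0 : T;
  oplusA : associative oplus;
  oplusC : commutative oplus;
  oplus0 : right_id mv0 oplus;
  negK : involutive neg;
  oplus1 : forall x, oplus x (neg mv0) = neg mv0;
  mv_lukasiewicz : forall x y,
    oplus (neg (oplus (neg x) y)) y = oplus (neg (oplus (neg y) x)) x;
  mv_leE : forall x y : T, (x <= y) = (oplus (neg x) y == neg mv0)
}.

#[short(type="mvAlgebraType")]
HB.structure Definition MVAlgebra d :=
  { T of Order.Lattice d T & Lattice_isMVAlgebra d T }.

HB.factory Record isMVAlgebra (d : Order.disp_t) T of Choice T := {
  oplus : T -> T -> T;
  neg : T -> T;
  mv0 : T;
  oplusA : associative oplus;
  oplusC : commutative oplus;
  oplus0 : right_id mv0 oplus;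
  negK : involutive neg;
  oplus1 : forall x, oplus x (neg mv0) = neg mv0;
  mv_lukasiewicz : forall x y,
    oplus (neg (oplus (neg x) y)) y = oplus (neg (oplus (neg y) x)) x
}.

HB.builders Context d T of isMVAlgebra d T.

Local Notation "x ⊕ y" := (oplus x y).
Local Notation "¬ x" := (neg x).
Local Notation I := (neg mv0).

Let le (x y : T) := ¬ x ⊕ y == I.
Let join (x y : T) := ¬ (¬ x ⊕ y) ⊕ y.
Let meet (x y : T) := ¬ (join (¬ x) (¬ y)).

Let joinC x y : join x y = join y x.
Proof. exact: mv_lukasiewicz. Qed.

Let le_refl : reflexive le.
Proof.
move=> x; apply/eqP; have := mv_lukasiewicz x I.
by rewrite negK !oplus1 (oplusC mv0) oplus0 => <-.
Qed.

Let le_join x y : le x y -> join x y = y.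
Proof. by move=> /eqP h; rewrite /join h negK oplusC oplus0. Qed.

Let le_anti : antisymmetric le.
Proof.
by move=> x y /andP[xy yx]; rewrite -(le_join xy) joinC (le_join yx).
Qed.

Let le_add x y : le x (x ⊕ y).
Proof. by rewrite /le oplusA (eqP (le_refl x)) oplusC oplus1. Qed.

Let leD x y : le x y -> exists t, y = x ⊕ t.
Proof.
move=> xy; exists (¬ (¬ y ⊕ x)).
by rewrite -{1}(le_join xy) joinC /join oplusC.
Qed.

Let le_trans : transitive le.
Proof. by move=> y x z /leD[t ->] /leD[s ->]; rewrite -oplusA; apply: le_add. Qed.

Let le_mono x y z : le x y -> le (x ⊕ z) (y ⊕ z).
Proof.
by move=> /leD[t ->]; rewrite -oplusA (oplusC t) oplusA; apply: le_add.
Qed.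

Let le_neg x y : le (¬ x) (¬ y) = le y x.
Proof. by rewrite /le negK oplusC. Qed.

Let le_joinr x y : le y (join x y).
Proof. by rewrite /join oplusC; apply: le_add. Qed.

Let joinP x y z : le (join x y) z = le x z && le y z.
Proof.
apply/idP/andP => [h|[xz yz]].
  split; last exact: le_trans (le_joinr x y) h.
  by apply: le_trans h; rewrite joinC; apply: le_joinr.
have <- : join y z = z by apply: le_join.
rewrite (joinC y z) /join; apply: le_mono; rewrite le_neg.
by apply: le_mono; rewrite le_neg.
Qed.

Let meetP x y z : le x (meet y z) = le x y && le x z.
Proof. by rewrite /meet -le_neg negK joinP !le_neg. Qed.

HB.instance Definition _ :=
  Order.Le_isPOrder.Build d T le_refl le_anti le_trans.
HB.instance Definition _ :=
  Order.POrder_MeetJoin_isLattice.Build d T meetP joinP.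
HB.instance Definition _ :=
  Lattice_isMVAlgebra.Build d T oplusA oplusC oplus0 negK oplus1
    mv_lukasiewicz (fun _ _ => erefl _).

HB.end.

Notation "x ⊕ y" := (oplus x y) : mv_scope.
Notation "¬ x" := (neg x) : mv_scope.
Notation "0" := mv0 : mv_scope.
Notation "1" := (neg mv0) : mv_scope.

Local Open Scope mv_scope.

Section Operations.
Context {d : Order.disp_t} {L : mvAlgebraType d}.
Implicit Types x y z : L.

Definition otimes x y : L := ¬ (¬ x ⊕ ¬ y).
Definition imp x y : L := ¬ x ⊕ y.

End Operations.

Notation "x ⊗ y" := (otimes x y) : mv_scope.
Notation "x ⇒ y" := (imp x y) : mv_scope.

Section Filters.
Context {d : Order.disp_t} {L : mvAlgebraType d}.
Implicit Types (x y z a b c : L) (F Q : set L).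

Definition order_filter F : Prop :=
  F !=set0 /\ forall x y, x <= y -> F x -> F y.

Definition implication_filter Q : Prop :=
  order_filter Q /\ forall x y, Q x -> Q y -> Q (x ⊗ y).

Definition prime_filter F : Prop :=
  [/\ order_filter F,
      F <> setT,
      forall x y, F x -> F y -> F (x `&` y)
    & forall x y, F (x `|` y) -> F x \/ F y].

Definition subordinate F a : set L := [set z | ~ F (z ⇒ a)].

Definition kernel F : set L := [set z | forall c, ~ F c -> ~ F (z ⇒ c)].

Lemma oplusNx x : ¬ x ⊕ x = 1.
Proof. by apply/eqP; rewrite -mv_leE. Qed.

Lemma mv_le1 x : x <= 1.
Proof. by rewrite mv_leE oplus1. Qed.

Lemma imp1x x : 1 ⇒ x = x.
Proof. by rewrite /imp negK oplusC oplus0. Qed.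

Lemma le_oplus x y : x <= x ⊕ y.
Proof. by rewrite mv_leE oplusA oplusNx oplusC oplus1. Qed.

Lemma leNN x y : (¬ x <= ¬ y) = (y <= x).
Proof. by rewrite !mv_leE negK oplusC. Qed.

Lemma le_oplusP x y : x <= y -> exists t, y = x ⊕ t.
Proof.
rewrite mv_leE => /eqP xy; exists (¬ (¬ y ⊕ x)).
by rewrite oplusC -mv_lukasiewicz xy negK oplusC oplus0.
Qed.

Lemma imp_otimes x y z : x ⊗ y ⇒ z = x ⇒ (y ⇒ z).
Proof. by rewrite /imp /otimes negK oplusA. Qed.

Lemma le_imp2r x y z : x <= y -> y ⇒ z <= x ⇒ z.
Proof.
rewrite -leNN => /le_oplusP[t xE].
by rewrite /imp xE -oplusA (oplusC t) oplusA le_oplus.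
Qed.

Lemma imp_trans x y z : (x ⇒ y) ⊗ (y ⇒ z) <= x ⇒ z.
Proof.
rewrite mv_leE -/(imp _ _) imp_otimes /imp; apply/eqP.
rewrite (oplusC (¬ x) z) (oplusA (¬ (¬ y ⊕ z))) mv_lukasiewicz.
by rewrite -oplusA (oplusC y) oplusA (oplusC _ (¬ (¬ z ⊕ y))) -oplusA oplusNx
  oplus1.
Qed.

Lemma imp_oplus x y z : x ⇒ y <= x ⊕ z ⇒ y ⊕ z.
Proof.
rewrite mv_leE /imp (oplusC (¬ (x ⊕ z))) !oplusA mv_lukasiewicz.
by rewrite -!oplusA (oplusA x) (oplusC (x ⊕ z)) oplusNx oplus1.
Qed.

Lemma order_filter1 F : order_filter F -> F 1.
Proof. by move=> [[x Fx] up]; apply: up Fx; apply: mv_le1. Qed.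

Lemma kernel_implication_filter F : order_filter F ->
  implication_filter (kernel F).
Proof.
move=> [F0 up]; split; first split.
- by exists 1 => c; rewrite imp1x.
- by move=> x y xy Kx c Fc /(up _ _ (le_imp2r c xy)); apply: Kx.
- by move=> x y Kx Ky c Fc; rewrite imp_otimes; apply/Kx/Ky.
Qed.

End Filters.

(* The filter property is bundled so that the quotient can be a type         *)
(* depending on the filter only.                                             *)
Record impFilter d (L : mvAlgebraType d) := ImpFilter {
  impfilter_set :> set L;
  impfilterP : implication_filter impfilter_set
}.

Section Quotient.
Context {d : Order.disp_t} {L : mvAlgebraType d} (Q : impFilter L).
Implicit Types x y z : L.

Definition mvcongr : rel L := fun x y =>
  `[< impfilter_set Q (x ⇒ y) /\ impfilter_set Q (y ⇒ x) >].

Lemma mvcongr_refl : reflexive mvcongr.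
Proof.
by move=> x; apply/asboolP; rewrite /imp oplusNx; split;
  apply: order_filter1; case: (impfilterP Q).
Qed.

Lemma mvcongr_sym : symmetric mvcongr.
Proof. by move=> x y; apply/asbool_equiv_eq; split=> -[]. Qed.

Lemma mvcongr_trans : transitive mvcongr.
Proof.
have [[_ up] QM] := impfilterP Q.
move=> y x z /asboolP[xy yx] /asboolP[yz zy]; apply/asboolP; split.
- exact: up (imp_trans x y z) (QM _ _ xy yz).
- exact: up (imp_trans z y x) (QM _ _ zy yx).
Qed.

Canonical mvcongr_equiv := EquivRel mvcongr mvcongr_refl mvcongr_sym
  mvcongr_trans.

Definition mvquot : Type := {eq_quot mvcongr}.

HB.instance Definition _ := EqQuotient.on mvquot.
HB.instance Definition _ := Choice.on mvquot.

Lemma mvcongr_neg x y : mvcongr x y -> mvcongr (¬ x) (¬ y).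
Proof.
by move=> /asboolP[xy yx]; apply/asboolP; rewrite /imp !negK oplusC (oplusC y).
Qed.

Lemma mvcongr_oplusr z x y : mvcongr x y -> mvcongr (x ⊕ z) (y ⊕ z).
Proof.
have [[_ up] _] := impfilterP Q.
move=> /asboolP[xy yx]; apply/asboolP.
by split; [move: xy | move: yx]; apply: up; apply: imp_oplus.
Qed.

Lemma mvcongr_oplus x x' y y' :
  mvcongr x x' -> mvcongr y y' -> mvcongr (x ⊕ y) (x' ⊕ y').
Proof.
move=> xx' yy'; apply: (mvcongr_trans (mvcongr_oplusr y xx')).
by rewrite !(oplusC x'); apply: mvcongr_oplusr.
Qed.

(* The canonical epimorphism. *)
Definition mvpi (x : L) : mvquot := \pi_mvquot x.

Definition quot_oplus (u v : mvquot) : mvquot := mvpi (repr u ⊕ repr v).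
Definition quot_neg (u : mvquot) : mvquot := mvpi (¬ repr u).

Lemma mvpi_eqP x y : reflect (mvpi x = mvpi y) (mvcongr x y).
Proof. exact: eqmodP. Qed.

Lemma mvpi_surj (u : mvquot) : exists x, mvpi x = u.
Proof. by exists (repr u); rewrite /mvpi reprK. Qed.

Lemma repr_mvpi x : mvcongr (repr (mvpi x)) x.
Proof. by apply/mvpi_eqP; rewrite /mvpi reprK. Qed.

Lemma mvpi_quot_oplus x y : mvpi (x ⊕ y) = quot_oplus (mvpi x) (mvpi y).
Proof.
by apply/esym/mvpi_eqP/mvcongr_oplus; apply: repr_mvpi.
Qed.

Lemma mvpi_quot_neg x : mvpi (¬ x) = quot_neg (mvpi x).
Proof. by apply/esym/mvpi_eqP/mvcongr_neg/repr_mvpi. Qed.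

Lemma quot_oplusA : associative quot_oplus.
Proof.
move=> u v w; have [[x <-] [y <-] [z <-]] :=
  And3 (mvpi_surj u) (mvpi_surj v) (mvpi_surj w).
by rewrite -!mvpi_quot_oplus oplusA.
Qed.

Lemma quot_oplusC : commutative quot_oplus.
Proof.
move=> u v; have [x <-] := mvpi_surj u; have [y <-] := mvpi_surj v.
by rewrite -!mvpi_quot_oplus oplusC.
Qed.

Lemma quot_oplus0 : right_id (mvpi 0) quot_oplus.
Proof.
by move=> u; have [x <-] := mvpi_surj u; rewrite -mvpi_quot_oplus oplus0.
Qed.

Lemma quot_negK : involutive quot_neg.
Proof.
by move=> u; have [x <-] := mvpi_surj u; rewrite -!mvpi_quot_neg negK.
Qed.

Lemma quot_oplus1 u : quot_oplus u (quot_neg (mvpi 0)) = quot_neg (mvpi 0).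
Proof.
have [x <-] := mvpi_surj u.
by rewrite -!mvpi_quot_neg -mvpi_quot_oplus oplus1.
Qed.

Lemma quot_lukasiewicz u v :
  quot_oplus (quot_neg (quot_oplus (quot_neg u) v)) v =
  quot_oplus (quot_neg (quot_oplus (quot_neg v) u)) u.
Proof.
have [x <-] := mvpi_surj u; have [y <-] := mvpi_surj v.
rewrite -(mvpi_quot_neg x) -(mvpi_quot_neg y).
rewrite -(mvpi_quot_oplus (¬ x)) -(mvpi_quot_oplus (¬ y)).
rewrite -(mvpi_quot_neg (¬ x ⊕ y)) -(mvpi_quot_neg (¬ y ⊕ x)).
by rewrite -(mvpi_quot_oplus _ y) -(mvpi_quot_oplus _ x) mv_lukasiewicz.
Qed.

HB.instance Definition _ := isMVAlgebra.Build d mvquot quot_oplusA quot_oplusC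
  quot_oplus0 quot_negK quot_oplus1 quot_lukasiewicz.

Lemma mvpi_oplus x y : mvpi (x ⊕ y) = mvpi x ⊕ mvpi y.
Proof. exact: mvpi_quot_oplus. Qed.

Lemma mvpi_neg x : mvpi (¬ x) = ¬ mvpi x.
Proof. exact: mvpi_quot_neg. Qed.

Lemma mvpi0 : mvpi 0 = 0.
Proof. by []. Qed.

End Quotient.

Definition kernel_filter d (L : mvAlgebraType d) (F : set L)
    (hF : prime_filter F) : impFilter L :=
  ImpFilter (kernel_implication_filter (let: And4 h _ _ _ := hF in h)).

(* Main.v *)
Require Import Defs.
From mathcomp Require Import all_boot all_order.
From mathcomp Require Import boolp classical_sets.
Local Open Scope classical_set_scope.
Local Open Scope order_scope.

(** Everything reduces to (iii): (ii) is (iii) used twice together with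
    antisymmetry of the quotient order, and (i) is a case of (ii).

    For (iii), [eta b <= eta a] means that [b ⇒ a] lies in the kernel, that is,
    [(b ⇒ a) ⇒ c] stays outside [F] whenever [c] does. Let [c] be outside [F].
    Since [F] is prime, enlarging [c] to [c `|` a] keeps it outside [F], so one
    may assume [a <= c] and write [c = a ⊕ u]. Then
    [(b ⇒ a) ⇒ c = ((b ⇒ a) ⇒ a) ⊕ u = (b `|` a) ⊕ u
                 = (b ⊕ u) `|` (a ⊕ u)],
    and here [a ⊕ u = c] is not in [F]. If the join were in [F], primality would
    put [b ⊕ u = ¬ u ⇒ b] in [F], while [a ⊕ u = ¬ u ⇒ a] is not: so [¬ u] would
    belong to [subordinate F a] and not to [subordinate F b].

    The algebraic ingredient is that [⊕] distributes over joins
    ([oplus_joinl]), which rests on prelinearity ([imp_prelinear]). *)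

Set Implicit Arguments.
Unset Strict Implicit.
Unset Printing Implicit Defensive.

Import Order.TTheory.
Local Open Scope mv_scope.

Section MVTheory.
Context {d : Order.disp_t} {L : mvAlgebraType d}.
Implicit Types x y z u : L.

Lemma leE_imp x y : (x <= y) = (x ⇒ y == 1).
Proof. exact: mv_leE. Qed.

(** The lattice is given only through its order, so the formula is recovered
    from the universal property: [(- ⇒ y) ⇒ y] is monotone, and by the
    Łukasiewicz axiom it sends any [z >= y] to [z] itself. *)
Lemma joinE_imp x y : x `|` y = (x ⇒ y) ⇒ y.
Proof.
have le_r v w : w <= (v ⇒ w) ⇒ w by rewrite /imp oplusC le_oplus.
have sym v w : (v ⇒ w) ⇒ w = (w ⇒ v) ⇒ v by exact: mv_lukasiewicz.
apply/eqP; rewrite eq_le leUx le_r andbT sym le_r /= -sym.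
have <- : (x `|` y ⇒ y) ⇒ y = x `|` y.
  have /eqP yz : y ⇒ x `|` y == 1 by rewrite -leE_imp leUr.
  by rewrite sym yz imp1x.
by do 2!apply: le_imp2r; rewrite leUl.
Qed.

(** The join is [(p ⇒ q) ⇒ q] with [p = x ⇒ y] and [q = y ⇒ x]. The Łukasiewicz
    axiom is used three times: to isolate a summand [¬ w ⊕ x] with [w = p ⇒ x],
    to turn it into one containing [p], hence [¬ x] and [y], and to trade this
    [y] for [w], hence for [x]. The sum then contains [x ⊕ ¬ x = 1]. *)
Lemma imp_prelinear x y : (x ⇒ y) `|` (y ⇒ x) = 1.
Proof.
rewrite joinE_imp; set p := x ⇒ y; set w := p ⇒ x.
have -> : (p ⇒ (y ⇒ x)) ⇒ (y ⇒ x) = ¬ (¬ (¬ w) ⊕ ¬ y) ⊕ ¬ y ⊕ x.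
  by rewrite /imp negK -oplusA /w /imp -(oplusA (¬ p)) (oplusC x) oplusA.
rewrite mv_lukasiewicz negK -oplusA.
have -> : ¬ w ⊕ x = ¬ (x ⇒ p) ⊕ p by exact: mv_lukasiewicz.
rewrite {2}/p /imp (oplusC (¬ x) y) (oplusC _ (y ⊕ ¬ x)) -oplusA oplusA.
rewrite (oplusC y (¬ w)) mv_lukasiewicz {2}/w /imp.
rewrite -!oplusA (oplusA x) (oplusC x) oplusNx.
by rewrite (oplusC 1) !oplus1.
Qed.

(** Both [x ⇒ y] and [y ⇒ x] lie below [(x `|` y) ⊕ u ⇒ (x ⊕ u) `|` (y ⊕ u)],
    so by prelinearity that implication is [1]. *)
Lemma oplus_joinl x y u : (x `|` y) ⊕ u = (x ⊕ u) `|` (y ⊕ u).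
Proof.
have mono v w t : v <= w -> v ⊕ t <= w ⊕ t.
  by move=> /le_oplusP[s ->]; rewrite -oplusA (oplusC s) oplusA le_oplus.
have imp_join v w : v ⇒ w <= (v `|` w) ⊕ u ⇒ (v ⊕ u) `|` (w ⊕ u).
  have vwE : v ⇒ w <= v `|` w ⇒ w.
    by rewrite joinE_imp -joinE_imp leUl.
  apply: (le_trans vwE); apply: (le_trans (imp_oplus _ _ u)).
  by rewrite /imp 2!(oplusC (¬ _)) mono // leUr.
apply/eqP; rewrite eq_le leUx !mono ?leUl ?leUr // !andbT.
rewrite leE_imp eq_le mv_le1 /= -(imp_prelinear x y) leUx imp_join /=.
by rewrite (joinC x) (joinC (x ⊕ u)) imp_join.
Qed.

Lemma imp_imp_oplus x y u : (y ⇒ x) ⇒ x ⊕ u = (y ⊕ u) `|` (x ⊕ u).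
Proof. by rewrite -oplus_joinl joinE_imp /imp oplusA. Qed.

Lemma kernel_subordinate (F : set L) a b : prime_filter F -> ~ F a ->
  subordinate F a `<=` subordinate F b -> kernel F (b ⇒ a).
Proof.
move=> [[_ up] _ _ Fprime] nFa sub c nFc Fbac.
have nFca : ~ F (c `|` a) by case/Fprime.
have [u cE] : exists u, c `|` a = a ⊕ u by apply: le_oplusP; apply: leUr.
have uF v : ¬ u ⇒ v = v ⊕ u by rewrite /imp negK oplusC.
have : F ((b ⇒ a) ⇒ c `|` a).
  apply: up Fbac; have /le_oplusP[t ->] : c <= c `|` a by apply: leUl.
  by rewrite /imp oplusA le_oplus.
rewrite cE imp_imp_oplus => /Fprime[Fbu|]; last by rewrite -cE.
have := sub (¬ u); rewrite /subordinate /= !uF -cE.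
by move=> /(_ nFca); apply.
Qed.

End MVTheory.

Lemma mvpi_le d (L : mvAlgebraType d) (Q : impFilter L) (x y : L) :
  impfilter_set Q (x ⇒ y) -> mvpi Q x <= mvpi Q y.
Proof.
move=> Qxy; rewrite mv_leE -mvpi_neg -mvpi_oplus -/(imp x y).
apply/eqP; rewrite -(mvpi0 Q) -mvpi_neg; apply/mvpi_eqP/asboolP; split.
  by rewrite /imp oplus1; apply: order_filter1; case: (impfilterP Q).
by rewrite imp1x.
Qed.

Theorem theorem4p6 (d : Order.disp_t) (L : mvAlgebraType d) (F : set L)
    (hF : prime_filter F) (a b : L) (ha : ~ F a) (hb : ~ F b) :
  let eta : L -> mvquot (kernel_filter hF) := mvpi (kernel_filter hF) in
  [/\ a <= b -> subordinate F a = subordinate F b -> eta a = eta b,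
      subordinate F a = subordinate F b -> eta a = eta b
    & subordinate F a `<=` subordinate F b -> eta b <= eta a].
Proof.
move=> eta.
have le_eta x y : ~ F x -> subordinate F x `<=` subordinate F y ->
    eta y <= eta x.
  by move=> nFx sub; apply: mvpi_le; apply: kernel_subordinate.
have eq_eta : subordinate F a = subordinate F b -> eta a = eta b.
  by move=> E; apply/eqP; rewrite eq_le !le_eta // E.
by split=> [_|//|]; [exact: eq_eta | exact: le_eta].
Qed.
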